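(* Let $X$ be a real Banach space, $K$ a nonempty compact convex subset of $X$, and $f:K\times K\to\mathbb{R}$ a bifunction with $f\in\mathcal{S}(K)$ such that $f_s$ is properly quasimonotone and has the upper sign property on $K$. Then $\operatorname{EP}(f,K)$ is nonempty.
   Context: For $h:X\to[-\infty,+\infty]$ let $\operatorname{epi}(h)=\{(x,\lambda)\in X\times\mathbb{R}:h(x)\le\lambda\}$. The lower semicontinuous regularization of $h$ is $h_s(x)=\inf\{\lambda\in\mathbb{R}:(x,\lambda)\in\overline{\operatorname{epi}(h)}\}$ (with $\inf\emptyset=+\infty$). For $f:K\times K\to\mathbb{R}$ and $x\in K$, extend $f(x,\cdot)$ to $X$ by $+\infty$ outside $K$ and put $f_s(x,\cdot)=(f(x,\cdot))_s$, regarded as a function on $K$. $\mathcal{S}(K)$ is the family of bifunctions $f:K\times K\to\mathbb{R}$ such that $f_s(x,y)\in\mathbb{R}$ for all $x,y\in K$. A bifunction $g:K\times K\to\mathbb{R}$ is properly quasimonotone if for all $x_1,\dots,x_n\in K$ and all $x\in\mathrm{co}(\{x_1,\dots,x_n\})$ there is $i\in\{1,\dots,n\}$ with $g(x_i,x)\le0$. $g$ has the upper sign property on $K$ if for every $x\in K$ and every $y\in K$: if $g(x_t,x)\le0$ for all $t\in\,]0,1[$, where $x_t=(1-t)x+ty$, then $g(x,y)\ge0$. $\operatorname{EP}(f,K)=\{x\in K:f(x,y)\ge0\text{ for all }y\in K\}$. *)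

(* Defs.v *)
From HB Require Import structures.
From mathcomp Require Import all_boot all_order all_algebra.
From mathcomp Require Import all_classical all_reals all_analysis.

Set Implicit Arguments.
Unset Strict Implicit.
Unset Printing Implicit Defensive.

Import Order.TTheory GRing.Theory Num.Theory.
Import numFieldNormedType.Exports.

Local Open Scope classical_set_scope.
Local Open Scope ring_scope.

(* A function on K * K is encoded as a total function on X * X; for
   convex K, its values outside K * K play no role in what follows. *)

Section EquilibriumProblem.
Context {R : realType} {X : normedModType R}.

Definition convex_hull (A : set X) : set X :=
  smallest (fun C : set X => convex_set C) A.

Definition epi (h : X -> \bar R) : set (X * R) :=
  [set p | (h p.1 <= p.2%:E)%E].

(* [ereal_inf set0 = +oo], in accordance with the convention inf {} = +oo. *)
Definition lsc_reg (h : X -> \bar R) (x : X) : \bar R :=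
  ereal_inf [set l%:E | l in [set l : R | closure (epi h) (x, l)]].

Definition lsc_bifun (K : set X) (f : X -> X -> R) (x : X) : X -> \bar R :=
  lsc_reg (patch (fun=> +oo%E) K (fun y => (f x y)%:E)).

Definition bifun_S (K : set X) : set (X -> X -> R) :=
  [set f | forall x y, K x -> K y -> lsc_bifun K f x y \is a fin_num].

(* f_s as a real-valued bifunction; [fine] loses no information on K * K when
   [f] belongs to [bifun_S K]. *)
Definition lsc_bifunR (K : set X) (f : X -> X -> R) (x y : X) : R :=
  fine (lsc_bifun K f x y).

Definition properly_quasimonotone (K : set X) (g : X -> X -> R) : Prop :=
  forall (n : nat) (x_ : 'I_n -> X) (x : X), (forall i, K (x_ i)) ->
    convex_hull (range x_) x -> exists i, g (x_ i) x <= 0.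

Definition upper_sign_property (K : set X) (g : X -> X -> R) : Prop :=
  forall x y, K x -> K y ->
    (forall t : R, 0 < t < 1 -> g ((1 - t) *: x + t *: y) x <= 0) ->
    0 <= g x y.

Definition EP (f : X -> X -> R) (K : set X) : set X :=
  [set x | K x /\ forall y, K y -> 0 <= f x y].

End EquilibriumProblem.

(* Main.v *)
From mathcomp Require Import all_boot.

(** Write [fs] for the regularized bifunction. Every [fs y] is lower
    semicontinuous, so the sets [G y] of the points [x] of [K] with
    [fs y x <= 0] are closed, and proper quasimonotonicity says that the convex
    hull of finitely many points [y] of [K] is covered by the corresponding
    [G y]. The theorem of Knaster, Kuratowski and Mazurkiewicz ([KKM]) then gives
    a point [x] common to all the [G y]. For [y] in [K] the whole segment from [x]
    to [y] lies in [K], so the upper sign property applies at [x] and yields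
    [0 <= fs x y]; this is at most [f x y], since regularizing lowers a function.

    By compactness it is enough to prove [KKM] for finitely many points. If the
    corresponding closed sets had no common point, then each point of [K] would
    stay at a fixed positive distance from one of these sets. Colour a fine grid
    on the simplex of barycentric coordinates by the index of such a set. The
    lemma [grid_cluster] finds a face [C] of the simplex and a point in it such
    that every colour of [C] occurs very close to this point, which is therefore
    in none of the sets indexed by [C]; but these sets cover the face.

    The lemma [grid_cluster] replaces Sperner's lemma, but no triangulation is
    involved: following Scarf, cells are sets of points that are dominant with
    respect to finitely many linear orders, here the orders of the grid by the
    various coordinates. An incomplete cell can be completed in exactly two ways,
    with one exception ([card_completions_real], [card_completions_slack]), and
    the usual parity argument provides a cell with all the colours
    ([colorful_dominant]). *)

Set Implicit Arguments.
Unset Strict Implicit.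
Unset Printing Implicit Defensive.

(** * Dominant sets of a finite family of linear orders *)

Section Scarf.
Variables (I V : finType) (r : I -> V -> nat).
Hypothesis r_inj : forall i, injective (r i).

(** The combinatorial substitute for a simplex: read [r i] as the ranking of the
    points by the [i]-th coordinate; [S] is dominant when no point beats all of
    [S] in every coordinate at once, so that the points of [S] crowd together. *)
Definition dominant (S : {set V}) :=
  [forall v, [exists i, [forall s in S, r i v <= r i s]]].

Lemma dominantP (S : {set V}) :
  reflect (forall v, exists i, forall s, s \in S -> r i v <= r i s)
    (dominant S).
Proof.
apply: (iffP forallP) => h v; have := h v.
  by move=> /existsP[i /forall_inP hi]; exists i.
by move=> [i hi]; apply/existsP; exists i; apply/forall_inP.
Qed.

Lemma dominantS (S T : {set V}) : T \subset S -> dominant S -> dominant T.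
Proof.
move=> /subsetP TS /dominantP h; apply/dominantP => v.
by have [i hi] := h v; exists i => s /TS; exact: hi.
Qed.

(** The default [t0] only serves to know that [T] is nonempty; by injectivity of
    the ranks the value does not depend on it. *)
Definition lowest (t0 : V) (T : {set V}) (i : I) : V :=
  [arg min_(t < t0 in T) r i t].

Lemma lowestP t0 (T : {set V}) i : t0 \in T ->
  lowest t0 T i \in T /\ forall t, t \in T -> r i (lowest t0 T i) <= r i t.
Proof. by move=> t0T; rewrite /lowest; case: arg_minnP. Qed.

(** Dominance of [T] tested at one of its own points [t] produces an order in
    which [t] comes first. *)
Lemma lowest_onto t0 (T : {set V}) :
  t0 \in T -> dominant T -> lowest t0 T @: I = T.
Proof.
move=> t0T /dominantP domT; apply/setP => t; apply/imsetP/idP.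
  by move=> [i _ ->]; have [] := lowestP i t0T.
move=> tT; have [i hi] := domT t; exists i => //; apply: (r_inj (i := i)).
have [mT hm] := lowestP i t0T.
by apply/eqP; rewrite eqn_leq hi// hm.
Qed.

Lemma lowest_twin t0 (T : {set V}) : t0 \in T -> dominant T -> #|T| < #|I| ->
  exists a b, a != b /\ lowest t0 T a = lowest t0 T b.
Proof.
move=> t0T domT cardT.
have /injectivePn[a [b ab mab]] : ~~ injectiveb (lowest t0 T).
  apply/negP => /injectiveP m_inj; move: cardT.
  by rewrite -(lowest_onto t0T domT) (card_imset _ m_inj) ltnn.
by exists a, b.
Qed.

(** The points that can be added to [T] without disturbing its lowest points,
    except possibly in order [a]. *)
Definition above t0 T a : {set V} :=
  [set v | [forall j, (j != a) ==> (r j (lowest t0 T j) < r j v)]].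

Lemma aboveP t0 T a v :
  reflect (forall j, j != a -> r j (lowest t0 T j) < r j v) (v \in above t0 T a).
Proof.
rewrite inE; apply: (iffP forallP) => h j; first by apply/implyP.
by apply/implyP; exact: h.
Qed.

Definition top_above t0 T a : {set V} :=
  [set v in above t0 T a | [forall u in above t0 T a, r a u <= r a v]].

Lemma card_top_above t0 T a :
  #|top_above t0 T a| = (above t0 T a != set0).
Proof.
have [Q0|/set0Pn[v0 v0Q]] := eqVneq (above t0 T a) set0.
  by apply: eq_card0 => v; rewrite inE Q0 inE.
case: (arg_maxnP (r a) v0Q) => v vQ vmax.
suff -> : top_above t0 T a = [set v] by rewrite cards1.
apply/setP => u; rewrite in_set in_set1; apply/andP/eqP.
  move=> [uQ /forall_inP umax]; apply: (r_inj (i := a)); apply/eqP.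
  by rewrite eqn_leq umax// andbT; exact: vmax.
by move=> ->; split=> //; apply/forall_inP => w; exact: vmax.
Qed.

Definition completions (T : {set V}) : {set V} :=
  [set v | v \notin T & dominant (v |: T)].

(** If [T] has one point less than there are orders, then exactly two orders [a]
    and [b] share their lowest point in [T]. A point completing [T] to a dominant
    set must become the lowest one in order [a] or in order [b], and among the
    points that could do so it must have the greatest rank in that order; hence
    the bound by two. *)
Section Wall.
Variables (t0 : V) (T : {set V}) (a b : I).
Hypotheses (t0T : t0 \in T) (domT : dominant T) (cardT : #|T|.+1 = #|I|).
Hypotheses (ab : a != b) (mab : lowest t0 T a = lowest t0 T b).
Let m := lowest t0 T.

(* Without [x], the map [m] still covers [T], which has as many points as there
   are remaining orders. *)
Let twin_inj x y : x != y -> m x = m y -> {in [set~ x] &, injective m}.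
Proof.
move=> xy mxy; apply/imset_injP.
have -> : m @: [set~ x] = T.
  rewrite -(lowest_onto t0T domT); apply/setP => t.
  apply/imsetP/imsetP => -[i]; first by exists i.
  move=> _ ->; have [->|ix] := eqVneq i x; last by exists i; rewrite ?inE.
  by exists y; rewrite ?inE // eq_sym.
by rewrite cardsC1 -cardT.
Qed.

Lemma above_notin x y v : x != y -> m x = m y ->
  v \in above t0 T x -> v \notin T.
Proof.
move=> xy mxy /aboveP vQ; apply/negP; rewrite -(lowest_onto t0T domT).
case/imsetP => j _ vE; have [jx|jx] := eqVneq j x; last first.
  by have := vQ _ jx; rewrite vE ltnn.
by have := vQ y; rewrite eq_sym xy vE jx -/(m x) -/(m y) mxy ltnn => /(_ isT).
Qed.

Let top_above_completes x y :
  x != y -> m x = m y -> top_above t0 T x \subset completions T.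
Proof.
move=> xy mxy; apply/subsetP => v; rewrite inE => /andP[vQ /forall_inP vmax].
rewrite inE (above_notin xy mxy vQ) /=; apply/dominantP => u.
have [uQ|] := boolP (u \in above t0 T x).
  exists x => s; rewrite in_setU1 => /predU1P[->|sT]; first exact: vmax.
  have /dominantP/(_ u)[i hi] := domT.
  have [<-|ix] := eqVneq i x; first exact: hi.
  have := aboveP _ _ _ _ uQ i ix.
  by rewrite ltnNge hi//; have [] := lowestP i t0T.
rewrite inE negb_forall => /existsP[j].
rewrite negb_imply -leqNgt => /andP[jx um].
exists j => s; rewrite in_setU1 => /predU1P[->|sT].
  by apply: leq_trans um (ltnW _); exact: (aboveP _ _ _ _ vQ).
by apply: leq_trans um _; have [_ ->] := lowestP j t0T.
Qed.

Let completes_top_above x y v : x != y -> m x = m y ->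
  v \notin T -> dominant (v |: T) -> r y (m y) < r y v ->
  v \in top_above t0 T x.
Proof.
move=> xy mxy vT /dominantP domS yv.
have vQ : v \in above t0 T x.
  apply/aboveP => j jx; have [->//|jy] := eqVneq j y.
  have [mT _] := lowestP j t0T.
  have [i hi] := domS (m j).
  have mij : m i = m j.
    have [miT hmi] := lowestP i t0T; apply: (r_inj (i := i)); apply/eqP.
    by rewrite eqn_leq hmi // hi // in_setU1 miT orbT.
  have ij : i = j.
    have [ix|ix] := eqVneq i x; last first.
      by apply: (twin_inj xy mxy) => //; rewrite !inE.
    suff jyE : j = y by rewrite jyE eqxx in jy.
    apply: (twin_inj xy mxy); rewrite ?inE ?jx 1?eq_sym//.
    by rewrite -mij ix.
  have := hi v (setU11 _ _); rewrite ij => le_v; rewrite ltn_neqAle le_v andbT.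
  by apply: contraNneq vT => /(r_inj (i := j)) <-; exact: mT.
rewrite inE vQ /=; apply/forall_inP => u /aboveP uQ.
have [i hi] := domS u.
have [<-|ix] := eqVneq i x; first by rewrite hi// setU11.
have := uQ i ix; rewrite ltnNge hi//.
by rewrite in_setU1; have [-> _] := lowestP i t0T; rewrite orbT.
Qed.

Lemma completionsE : completions T = top_above t0 T a :|: top_above t0 T b.
Proof.
apply/eqP; rewrite eqEsubset subUset.
have ba : b != a by rewrite eq_sym.
rewrite (top_above_completes ab mab) (top_above_completes ba (esym mab)) !andbT.
apply/subsetP => v; rewrite inE => /andP[vT domS].
have /dominantP/(_ (m a))[i hi] := domS.
have [mT _] := lowestP a t0T; have [iT hmi] := lowestP i t0T.
have mia : m i = m a.
  apply: (r_inj (i := i)); apply/eqP.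
  by rewrite eqn_leq hmi // hi // in_setU1 iT orbT.
have lt_v : r i (m i) < r i v.
  have := hi v (setU11 _ _); rewrite mia => le_v; rewrite ltn_neqAle le_v andbT.
  by apply: contraNneq vT => /(r_inj (i := i)) <-; exact: mT.
have [ia|ia] := eqVneq i a.
  rewrite in_setU orbC; apply/orP; left.
  by apply: (completes_top_above ba (esym mab)) => //; rewrite -ia.
have ib : i = b.
  by apply: (twin_inj ab mab); rewrite ?inE // mia.
rewrite in_setU; apply/orP; left.
by apply: (completes_top_above ab mab) => //; rewrite -ib.
Qed.

Lemma card_completions :
  #|completions T| = (above t0 T a != set0) + (above t0 T b != set0).
Proof.
rewrite completionsE cardsU !card_top_above.
suff -> : top_above t0 T a :&: top_above t0 T b = set0 by rewrite cards0 subn0.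
apply/setP => v; rewrite in_set0; apply/negP => /setIP[].
rewrite in_set => /andP[/aboveP va _]; rewrite in_set => /andP[/aboveP vb _].
have /dominantP/(_ v)[i hi] := domT; have [iT _] := lowestP i t0T.
have [ia|ia] := eqVneq i a; last by have := va i ia; rewrite ltnNge hi.
by have := vb i; rewrite ia ab => /(_ isT); rewrite -ia ltnNge hi.
Qed.
End Wall.

(** The slack points [e i] are vertices at infinity: [e i] comes last in its own
    order and beats the non-slack points in all the other orders. They provide
    the completions that would otherwise be missing at the boundary, except for
    the set of all slack points but one, which has a single completion. *)
Section Slack.
Variables (e : I -> V) (v0 : V) (c : V -> I).
Hypothesis ce : forall i, c (e i) = i.
Hypothesis e_low : forall i v, r i (e i) <= r i v.
Hypothesis e_high : forall i j v, i != j ->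
  v \notin codom e -> r i v < r i (e j).
Hypothesis v0_real : v0 \notin codom e.

Let e_lt i v : v \notin codom e -> r i (e i) < r i v.
Proof.
move=> vr; rewrite ltn_neqAle e_low andbT; apply: contraNneq vr.
by move=> /(r_inj (i := i)) <-; exact: codom_f.
Qed.

(** A non-slack point in [T] makes the slack point of either twin order a
    candidate, so that both completions exist. *)
Lemma card_completions_real t (T : {set V}) : t \in T -> t \notin codom e ->
  dominant T -> #|T|.+1 = #|I| -> #|completions T| = 2.
Proof.
move=> tT tr domT cardT.
have [|a [b [ab mab]]] := lowest_twin tT domT; first by rewrite -cardT.
rewrite (card_completions tT domT cardT ab mab).
suff Q x y : x != y -> lowest t T x = lowest t T y -> above t T x != set0.
  by rewrite (Q _ _ ab mab) (Q b a) // eq_sym.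
move=> xy mxy; apply/set0Pn; exists (e x); apply/aboveP => j jx.
have [jT jlow] := lowestP j tT.
rewrite (leq_ltn_trans (jlow t tT)) //.
by apply: e_high.
Qed.

(** One of the twin orders is [k], and any non-slack point is a candidate for it.
    A candidate for the other one, [b], would have to beat [e b] in order [k],
    which no non-slack point does, and to beat [e j] in order [j] for the
    remaining [j]; this leaves [e b] and [e k], and neither beats [e b] in
    order [k]. *)
Lemma card_completions_slack (k : I) :
  1 < #|I| -> #|completions (e @: [set~ k])| = 1.
Proof.
move=> I_gt1; have e_inj := can_inj ce; set T := e @: _.
have eT j : (e j \in T) = (j != k) by rewrite mem_imset // !inE.
have cardT : #|T|.+1 = #|I|.
  by rewrite card_imset // cardsC1 prednK // ltnW.
have [t0 t0T] : exists t0, t0 \in T by apply/card_gt0P; rewrite -ltnS cardT.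
have Te t : t \in T -> exists2 j, j != k & t = e j.
  by case/imsetP => j; rewrite !inE => jk ->; exists j.
have domT : dominant T.
  apply/dominantP => v; have [/codomP[i ->]|vr] := boolP (v \in codom e).
    by exists i => s _.
  exists k => s /Te[j jk ->]; apply/ltnW/e_high => //; by rewrite eq_sym.
have me j : j != k -> lowest t0 T j = e j.
  move=> jk; have [_ h] := lowestP j t0T; apply: (r_inj (i := j)); apply/eqP.
  by rewrite eqn_leq e_low andbT h // eT.
have [|a [b [ab mab]]] := lowest_twin t0T domT; first by rewrite -cardT.
suff [b' [kb' mkb']] : exists b', k != b' /\ lowest t0 T k = lowest t0 T b'.
  rewrite (card_completions t0T domT cardT kb' mkb').
  have -> : above t0 T k != set0.
    by apply/set0Pn; exists v0; apply/aboveP => j jk; rewrite me // e_lt.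
  suff -> : above t0 T b' = set0 by rewrite eqxx.
  apply/setP => u; rewrite in_set0; apply/negP => /aboveP uQ.
  have := uQ k kb'; rewrite mkb' me 1?eq_sym // => uk.
  have [/codomP[j uE]|ur] := boolP (u \in codom e); last first.
    by have := e_high kb' ur; rewrite ltnNge (ltnW uk).
  have [jk|jk] := eqVneq j k; first by move: uk; rewrite uE jk ltnNge e_low.
  have [jb|jb] := eqVneq j b'; first by move: uk; rewrite uE jb ltnn.
  by have := uQ j jb; rewrite me // uE ltnn.
have [ak|ak] := eqVneq a k; first by exists b; rewrite -ak; split.
have [bk|bk] := eqVneq b k; last first.
  by move: mab; rewrite (me a ak) (me b bk) => /e_inj abE; rewrite abE eqxx in ab.
by exists a; rewrite -bk; split; rewrite 1?eq_sym.
Qed.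

Definition cell (S : {set V}) := (#|S| == #|I|) && dominant S.
Definition wall k (T : {set V}) := (#|T|.+1 == #|I|) && (c @: T == [set~ k]).
Definition facets k (S : {set V}) := [set x in S | c @: (S :\ x) == [set~ k]].

(** Both sides count the pairs made of a wall and of a cell that contains it. *)
Lemma cell_wall_count k :
  \sum_(S | cell S) #|facets k S| = \sum_(T | wall k T) #|completions T|.
Proof.
under eq_bigr do rewrite -sum1_card.
under [RHS]eq_bigr do rewrite -sum1_card.
rewrite (exchange_big_dep xpredT) // [RHS](exchange_big_dep xpredT) //=.
apply: eq_bigr => x _.
rewrite (reindex_onto (fun T => x |: T) (fun S => S :\ x)) /=; last first.
  by move=> S /andP[_]; rewrite inE => /andP[xS _]; rewrite setD1K.
apply: eq_bigl => T; rewrite /cell /wall !inE eqxx /=.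
have [xT|xT] := boolP (x \in T).
  rewrite andbF; apply/negbTE; apply/nandP; right; apply: contraL xT => /eqP <-.
  by rewrite !inE eqxx.
rewrite setU1K // eqxx cardsU1 xT /=.
by case: eqP; case: eqP; case: (dominant _).
Qed.

(** If removing [x] leaves all the colours but [k], and the colour of [x] is not
    [k], then exactly one further point [y] has the colour of [x], and the
    removable points are [x] and [y]. *)
Lemma facets_even k (S : {set V}) :
  #|S| = #|I| -> c @: S != setT -> 2 %| #|facets k S|.
Proof.
move=> cardS cS; have [->|/set0Pn[x]] := eqVneq (facets k S) set0.
  by rewrite cards0.
rewrite inE => /andP[xS /eqP cx].
have cxk : c x != k.
  apply: contraNneq cS => cxk; apply/eqP/setP => i; rewrite in_setT.
  have [->|ik] := eqVneq i k; first by rewrite -cxk imset_f.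
  have : i \in c @: (S :\ x) by rewrite cx !inE.
  by case/imsetP => y; rewrite inE => /andP[_ yS] ->; rewrite imset_f.
have c_inj : {in S :\ x &, injective c}.
  apply/imset_injP; rewrite cx cardsC1 -cardS (cardsD1 x) xS //.
have /imsetP[y] : c x \in c @: (S :\ x) by rewrite cx !inE.
rewrite in_setD1 => /andP[yx yS] cxy.
suff -> : facets k S = [set x; y] by rewrite cards2 eq_sym yx.
apply/setP => z; rewrite in_set in_set2; apply/andP/orP; last first.
  case=> /eqP ->; first by rewrite cx eqxx.
  split=> //; rewrite -cx; apply/eqP/setP => i; apply/imsetP/imsetP => -[w].
    rewrite in_setD1 => /andP[wy wS] ->; have [->|wx] := eqVneq w x.
      by exists y => //; rewrite in_setD1 yx.
    by exists w => //; rewrite in_setD1 wx.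
  rewrite in_setD1 => /andP[wx wS] ->; have [->|wy] := eqVneq w y.
    by exists x => //; rewrite in_setD1 eq_sym yx.
  by exists w => //; rewrite in_setD1 wy.
move=> [zS /eqP cz]; have [->|zx] := eqVneq z x; first by left.
right; have : c z \in c @: (S :\ z).
  rewrite cz -cx imset_f // in_setD1 zx //.
case/imsetP => w; rewrite in_setD1 => /andP[wz wS] czw.
have [wx|wx] := eqVneq w x.
  by apply/eqP; apply: c_inj; rewrite ?in_setD1 ?zx ?yx // czw wx.
case/eqP: wz; apply: c_inj => //; by rewrite in_setD1 ?zx ?wx.
Qed.

(** Among the walls, only the set of all slack points but [e k] contains no
    non-slack point, since a slack point is determined by its colour; every
    other wall has no completion or two. *)
Lemma odd_completions k :
  1 < #|I| -> odd (\sum_(T | wall k T) #|completions T|).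
Proof.
move=> I_gt1; have e_inj := can_inj ce.
rewrite (bigD1 (e @: [set~ k])) /=; last first.
  rewrite /wall card_imset // cardsC1 prednK ?eqxx 1?ltnW //=.
  rewrite -imset_comp (eq_imset (g := id)); last by move=> i; exact: ce.
  by rewrite imset_id.
rewrite card_completions_slack // add1n /= -dvdn2.
apply: dvdn_sum => T /andP[/andP[/eqP cardT /eqP cT] Te].
have [[t tT tr]|T_slack] : (exists2 t, t \in T & t \notin codom e) \/
    (forall t, t \in T -> t \in codom e).
  have [/existsP[t /andP[]]|] :=
    boolP [exists t, (t \in T) && (t \notin codom e)].
    by left; exists t.
  rewrite negb_exists => /forallP h; right => t tT.
  by have := h t; rewrite tT /= negbK.
  have [domT|ndomT] := boolP (dominant T).
    by rewrite (card_completions_real tT tr).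
  rewrite (_ : completions T = set0) ?cards0 //; apply/setP => v.
  rewrite !inE; apply/negP => /andP[_ /(dominantS (subsetU1 v T))].
  exact/negP.
case/eqP: Te; rewrite -cT -imset_comp.
rewrite -[LHS]imset_id; apply: eq_in_imset => t /T_slack /codomP[i ->] /=.
by rewrite ce.
Qed.

(** Scarf's lemma, the parity argument of Sperner's lemma for orders instead of
    triangulations: the number of pairs (cell, wall in it) is odd, while a cell
    that misses a colour contributes an even number of them. *)
Theorem colorful_dominant : exists2 S, dominant S & c @: S = setT.
Proof.
(* With a single order, walls are empty and have no lowest point. *)
have [I_gt1|I_le1] := ltnP 1 #|I|; last first.
  have I1 (i j : I) : i = j by have -> := fintype_le1P I_le1 j i.
  have [v _ vmax] := @arg_maxnP V v0 xpredT (r (c v0)) isT.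
  exists [set v]; last first.
    by apply/setP => i; rewrite in_setT imset_set1 (I1 i (c v)) set11.
  apply/dominantP => u; exists (c v0) => s /set1P ->; exact: vmax.
have := odd_completions (c v0) I_gt1; rewrite -cell_wall_count.
have [/existsP[S /andP[/andP[_ domS] /eqP cS]] _|] :=
    boolP [exists S : {set V}, cell S && (c @: S == setT)].
  by exists S.
rewrite negb_exists => /forallP noS; rewrite -[odd _]negbK -dvdn2.
rewrite dvdn_sum // => S cS; apply: facets_even; first by case/andP: cS => /eqP.
by have := noS S; rewrite cS.
Qed.
End Slack.

End Scarf.

(** * A grid on the simplex *)

Section Grid.
Variables (I : finType) (N : nat).

(** The points of the standard simplex with barycentric coordinates in the
    multiples of [1/N], scaled by [N]. *)
Definition grid := {y : {ffun I -> 'I_N.+1} | \sum_i y i == N}.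
Definition gcoord (y : grid) (i : I) : nat := val y i.

Lemma sum_gcoord y : \sum_i gcoord y i = N.
Proof. exact/eqP/(valP y). Qed.

Lemma grid_fill (g : I -> nat) j : \sum_i g i <= N ->
  exists y : grid, forall i, gcoord y i = g i + (i == j) * (N - \sum_i g i).
Proof.
move=> gN; pose h i := g i + (i == j) * (N - \sum_i g i).
have hN : \sum_i h i = N.
  rewrite big_split /= [X in _ + X](bigD1 j) //= eqxx mul1n.
  by rewrite [X in _ + (_ + X)]big1 ?addn0 ?subnKC // => i /negbTE ->.
have hlt i : h i < N.+1 by rewrite ltnS -[leqRHS]hN (bigD1 i) //= leq_addr.
have yP : \sum_i [ffun i => Ordinal (hlt i)] i == N.
  by rewrite -[eqbRHS]hN; apply/eqP/eq_bigr => i _; rewrite ffunE.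
exists (exist (fun y : {ffun I -> 'I_N.+1} => \sum_i y i == N) _ yP) => i.
by rewrite /gcoord /= ffunE.
Qed.

(** The points of the grid are ranked by their [i]-th coordinate; the position in
    the enumeration of the grid breaks the ties. All these ranks are at most
    [N.+1 * #|grid|], beyond which the slack points of the other orders lie. *)
Definition slack_rank (i : I) (v : I + grid) : nat :=
  match v with
  | inl j => if i == j then 0 else (N.+1 * #|{: grid}|).+1 + enum_rank j
  | inr y => (gcoord y i * #|{: grid}| + enum_rank y).+1
  end.

Lemma slack_rank_lt i j y :
  i != j -> slack_rank i (inr y) < slack_rank i (inl j).
Proof.
move=> /negbTE /= ->; rewrite addSn !ltnS; apply: leq_trans (leq_addr _ _).
rewrite mulSn addnC -addSn; apply: leq_add; first exact: ltn_ord.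
by rewrite leq_mul2r -ltnS ltn_ord orbT.
Qed.

Lemma slack_rank_mono i y y' :
  gcoord y i < gcoord y' i -> slack_rank i (inr y) < slack_rank i (inr y').
Proof.
move=> yy'; rewrite /= ltnS.
apply: (@leq_trans (gcoord y' i * #|{: grid}|)); last exact: leq_addr.
apply: leq_trans (_ : (gcoord y i).+1 * #|{: grid}| <= _).
  by rewrite mulSn addnC ltn_add2r ltn_ord.
by rewrite leq_mul2r yy' orbT.
Qed.

Lemma slack_rank_inj i : injective (slack_rank i).
Proof.
move=> [j|y] [j'|y'].
- rewrite /=; have [<-|ij] := eqVneq i j; have [<-|ij'] := eqVneq i j' => //.
  by move/addnI/val_inj/enum_rank_inj ->.
- have [<-|ij] := eqVneq i j; first by rewrite /= eqxx.
  by have := slack_rank_lt y' ij => /[swap] ->; rewrite ltnn.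
- have [<-|ij] := eqVneq i j'; first by rewrite /= eqxx.
  by have := slack_rank_lt y ij => /[swap] ->; rewrite ltnn.
- have [/slack_rank_mono/[swap]->|/slack_rank_mono/[swap]->|yy'] :=
    ltngtP (gcoord y i) (gcoord y' i).
  + by rewrite ltnn.
  + by rewrite ltnn.
  + by rewrite /= yy' => /succn_inj/addnI/val_inj/enum_rank_inj ->.
Qed.

Lemma slack_rank_coord i y y' :
  slack_rank i (inr y) <= slack_rank i (inr y') -> gcoord y i <= gcoord y' i.
Proof.
rewrite leqNgt (leqNgt (gcoord y i)).
apply: contra; exact: slack_rank_mono.
Qed.

(** [C] indexes the slack points left out by the colourful dominant set: a slack
    point in that set already accounts for its own colour and for its own
    order. *)
Lemma grid_dominant (c : grid -> I) : I ->
  exists (S : {set grid}) (C : {set I}),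
    (forall i, i \in C -> exists2 s, s \in S & c s = i) /\
    (forall y, exists2 i, i \in C & forall s, s \in S ->
      gcoord y i <= gcoord s i).
Proof.
move=> i0.
have [|y0 _] := @grid_fill (fun=> 0) i0; first by rewrite big1.
pose c' (v : I + grid) := match v with inl i => i | inr y => c y end.
have real_inr y : inr y \notin codom (@inl I grid) by apply/negP => /codomP[].
have [|||S /dominantP domS cS] := @colorful_dominant I _ slack_rank
    slack_rank_inj inl (inr y0) c' (fun=> erefl).
- by move=> i v; rewrite /= eqxx.
- by move=> i j [k|y]; [rewrite codom_f|move=> ij _; exact: slack_rank_lt].
- exact: real_inr.
exists [set y | inr y \in S], [set i | inl i \notin S]; split.
  move=> i; rewrite inE => iS; have : i \in c' @: S by rewrite cS.
  case/imsetP => -[j|y] vS /= iE; last by exists y; rewrite ?inE.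
  by rewrite iE vS in iS.
move=> y; have [i hi] := domS (inr y); exists i => [|s].
  by rewrite inE; apply/negP => /hi; rewrite /= eqxx.
by rewrite inE => /hi; exact: slack_rank_coord.
Qed.

(** Let [m] be the vector of the least coordinates over [S], with zero outside [C].
    If its sum were at most [N - #|C|], then every coordinate in [C] could be
    raised by one inside the grid, against dominance. So [m] almost exhausts
    [N]: each point of [S] is close to [m], and so is a grid point [z] obtained
    by adding the small missing amount to a coordinate in [C]. *)
Lemma grid_cluster (c : grid -> I) : I ->
  exists (C : {set I}) (z : grid),
    (forall i, i \notin C -> gcoord z i = 0) /\
    (forall i, i \in C -> exists2 s, c s = i & forall j,
      gcoord s j <= gcoord z j + #|I| /\ gcoord z j <= gcoord s j + #|I|).
Proof.
move=> i0; have [S [C [SC dom]]] := grid_dominant c i0.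
have [|y0 _] := @grid_fill (fun=> 0) i0; first by rewrite big1.
have [i1 i1C _] := dom y0; have [s0 s0S _] := SC i1 i1C.
pose m i := if i \in C then gcoord [arg min_(s < s0 in S) gcoord s i] i else 0.
have m_le s i : s \in S -> m i <= gcoord s i.
  by rewrite /m; case: ifP => // _ sS; case: arg_minnP => // t _; exact.
have mN : \sum_i m i <= N.
  by rewrite -[leqRHS](sum_gcoord s0); apply: leq_sum => i _; exact: m_le.
have gap : N - \sum_i m i <= #|I|.
  rewrite leqNgt; apply/negP => big.
  have [|y yE] := @grid_fill (fun i => m i + (i \in C)) i0.
    rewrite big_split /= -leq_subRL //.
    apply: leq_trans (ltnW big); rewrite -sum1_card big_mkcond /=.
    by apply: leq_sum => i _; case: (i \in C).
  have [i iC hi] := dom y.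
  have := yE i; rewrite iC /m iC; case: arg_minnP => // t tS _ yi.
  by have := hi t tS; rewrite yi addn1 addSn ltnNge leq_addr.
have [z zE] := grid_fill i1 mN.
exists C, z; split=> [i iC|i iC].
  rewrite zE /m (negbTE iC) add0n; case: eqP => // ii1.
  by rewrite ii1 i1C in iC.
have [s sS cs] := SC i iC; exists s => // j; rewrite zE; split; last first.
  apply: leq_add; first exact: m_le.
  by case: eqP => //=; rewrite mul1n.
apply: leq_trans (_ : m j + #|I| <= _); last by rewrite leq_add2r leq_addr.
rewrite -leq_subLR; apply: leq_trans gap.
have -> : N - \sum_i m i = \sum_i (gcoord s i - m i).
  by rewrite sumnB ?sum_gcoord // => k _; exact: m_le.
by rewrite (bigD1 j) //= leq_addr.
Qed.
End Grid.

Require Import Defs.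
From mathcomp Require Import finmap.
From mathcomp Require Import all_boot all_order all_algebra.
From mathcomp Require Import all_classical all_reals all_analysis.
From mathcomp Require Import ring lra.

Import Order.TTheory GRing.Theory Num.Theory.
Import numFieldNormedType.Exports.
Local Open Scope classical_set_scope.
Local Open Scope ring_scope.

(** * Barycenters in convex sets *)

Section Convexity.
Variables (R : realType) (X : normedModType R).

Lemma convex_set_segment (D : set X) (x y : X) (t : R) : convex_set D ->
  0 <= t <= 1 -> D x -> D y -> D (t *: x + (1 - t) *: y).
Proof.
move=> cD /andP[t0 t1] Dx Dy.
by have := cD x y (Itv01 t0 t1); rewrite !inE => /(_ Dx Dy).
Qed.

Lemma convex_set_barycenter (J : eqType) (p : J -> X) (D : set X)
    (s : seq J) (a : J -> R) :
  convex_set D -> (forall j, j \in s -> 0 <= a j) ->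
  (forall j, j \in s -> a j != 0 -> D (p j)) ->
  0 < \sum_(j <- s) a j ->
  D ((\sum_(j <- s) a j)^-1 *: \sum_(j <- s) a j *: p j).
Proof.
move=> cD; elim: s => [|j s ih] a_ge0 aD; first by rewrite big_nil ltxx.
have {}ih := ih (fun k ks => a_ge0 k (mem_behead (s := j :: s) ks))
  (fun k ks => aD k (mem_behead (s := j :: s) ks)).
rewrite !big_cons; set A := \sum_(_ <- _) _; set P := \sum_(_ <- _) _.
have A_ge0 : 0 <= A.
  by rewrite /A big_seq sumr_ge0 // => k ks; rewrite a_ge0 // in_cons ks orbT.
have [aj0|aj_neq0] := eqVneq (a j) 0.
  by rewrite aj0 scale0r !add0r; exact: ih.
have Dpj : D (p j) by apply: aD => //; rewrite mem_head.
have aj_gt0 : 0 < a j by rewrite lt_neqAle eq_sym aj_neq0 a_ge0 // mem_head.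
move=> S_gt0; have [A0|A_neq0] := eqVneq A 0.
  suff -> : P = 0 by rewrite A0 !addr0 scalerA mulVf // scale1r.
  rewrite /P big_seq big1 // => k ks; suff -> : a k = 0 by rewrite scale0r.
  apply/eqP; move: A0 => /eqP; rewrite /A big_seq psumr_eq0; last first.
    by move=> i si; rewrite a_ge0 // in_cons si orbT.
  by move=> /allP /(_ k ks); rewrite ks.
have A_gt0 : 0 < A by rewrite lt_neqAle eq_sym A_neq0.
have -> : (a j + A)^-1 *: (a j *: p j + P) =
    (a j / (a j + A)) *: p j + (1 - a j / (a j + A)) *: (A^-1 *: P).
  rewrite scalerDr !scalerA [_^-1 * a j]mulrC; congr (_ + _ *: _).
  by field; rewrite A_neq0 gt_eqF.
apply: convex_set_segment => //; last exact: ih.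
by rewrite divr_ge0 ?(ltW aj_gt0) ?(ltW S_gt0) //= ler_pdivrMr // mul1r lerDl.
Qed.

End Convexity.

(** * The theorem of Knaster, Kuratowski and Mazurkiewicz *)

Section KKM.
Variables (R : realType) (X : normedModType R).
Variables (K : set X) (G : X -> set X).
Hypotheses (cptK : compact K) (convK : convex_set K).
Hypothesis closedG : forall y, K y -> closed (G y).
Hypothesis coverG : forall n (p : 'I_n -> X) x, (forall i, K (p i)) ->
  convex_hull (range p) x -> exists i, G (p i) x.

(** A Lebesgue number for the cover of [K] by the complements of the
    [G (p i)]. *)
Lemma missed_uniformly (I : finType) (p : I -> X) : (forall i, K (p i)) ->
  (forall x, K x -> exists i, ~ G (p i) x) ->
  exists2 e : R, 0 < e &
    forall x, K x -> exists i, forall y, `|x - y| < e -> ~ G (p i) y.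
Proof.
move=> Kp noG.
pose P (e : R) x := exists i, forall y, `|x - y| < e -> ~ G (p i) y.
have /compact_near_coveringP/(_ R (0^'+) P _) near_cover := cptK.
have : \forall e \near 0^'+, K `<=` P e.
  apply: near_cover => x /noG[i nGx].
  have /nbhs_normP[d /= d0 dG] : nbhs x (~` G (p i)).
    by apply: open_nbhs_nbhs; split => //; apply/closed_openC/closedG.
  exists (ball x (d / 2), [set e | e < d / 2]) => /=.
    split; first by apply: nbhsx_ballx; rewrite divr_gt0.
    by apply: nbhs_right_lt; rewrite divr_gt0.
  move=> [x' e] /= [xx' ed]; exists i => y x'y; apply: dG => /=.
  rewrite -ball_normE /= in xx'.
  rewrite -(subrKA x') (le_lt_trans (ler_normD _ _)) //.
  by rewrite [ltRHS]splitr ltrD // (lt_trans x'y).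
by move=> /(filterI (nbhs_right_gt 0))/filter_ex[e [e0 h]]; exists e.
Qed.

Definition grid_point (I : finType) (p : I -> X) N (y : grid I N) : X :=
  N%:R^-1 *: \sum_i (gcoord y i)%:R *: p i.

Lemma grid_point_convex (I : finType) (p : I -> X) N (y : grid I N.+1)
    (D : set X) : convex_set D ->
  (forall i, gcoord y i != 0%N -> D (p i)) -> D (grid_point p y).
Proof.
move=> cD Dp; have sumN : \sum_i (gcoord y i)%:R = N.+1%:R :> R.
  by rewrite -natr_sum sum_gcoord.
rewrite /grid_point -sumN; apply: convex_set_barycenter cD _ _ _ => [i _|i _|].
- exact: ler0n.
- by rewrite pnatr_eq0; exact: Dp.
- by rewrite sumN ltr0n.
Qed.

Lemma grid_point_dist (I : finType) (p : I -> X) N d (y z : grid I N) :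
  (forall i, gcoord y i <= gcoord z i + d /\ gcoord z i <= gcoord y i + d)%N ->
  `|grid_point p y - grid_point p z| <= N%:R^-1 * (d%:R * \sum_i `|p i|).
Proof.
move=> yz; rewrite -scalerBr normrZ ger0_norm ?invr_ge0 //.
rewrite ler_wpM2l ?invr_ge0 // -sumrB mulr_sumr.
rewrite (le_trans (ler_norm_sum _ _ _)) //.
apply: ler_sum => i _; rewrite -scalerBl normrZ ler_wpM2r //.
have [] := yz i; rewrite -!(ler_nat R) !natrD => yz1 yz2.
by rewrite ler_norml; apply/andP; split; lra.
Qed.

(** Otherwise colour each point of a fine grid by an index [i] whose set
    [G (p i)] stays at distance at least [e] from it. The cluster of
    [grid_cluster] lies near a single point of the hull of the [p i], [i \in C],
    and carries all the colours in [C]; that point is thus in no [G (p i)] with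
    [i \in C], against the covering hypothesis. *)
Lemma KKM_finite (I : finType) (p : I -> X) : K !=set0 -> (forall i, K (p i)) ->
  exists2 x, K x & forall i, G (p i) x.
Proof.
move=> [x0 Kx0] Kp; have [[i0]|I0] := pselect (inhabited I); last first.
  by exists x0 => // i; case: I0.
apply: contrapT => noG.
have [|e e0 eG] := missed_uniformly Kp.
  move=> x Kx; apply: contrapT => allG; apply: noG; exists x => // i.
  by apply: contrapT => nG; apply: allG; exists i.
pose L := #|I|%:R * \sum_i `|p i|.
have [N LN] : exists N, N.+1%:R^-1 * L < e.
  exists (Num.truncn (L / e)).
  by rewrite mulrC ltr_pdivrMr // mulrC -ltr_pdivrMr // truncnS_gt.
have /choice[c cG] (y : grid I N.+1) :
    exists i, forall x, `|grid_point p y - x| < e -> ~ G (p i) x.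
  by apply: eG; apply: grid_point_convex.
have [C [z [zC near_z]]] := grid_cluster c i0.
have [k Gk] : exists k : 'I_#|C|, G (p (enum_val k)) (grid_point p z).
  apply: (@coverG _ (fun k => p (enum_val k))) => // D [cD Dp].
  apply: grid_point_convex => // i iz; apply: Dp.
  have iC : i \in C by apply: contraNT iz => /zC ->.
  by exists (enum_rank_in iC i) => //; rewrite enum_rankK_in.
have [s cs sz] := near_z _ (enum_valP k).
apply: (cG s (grid_point p z)); last by rewrite cs.
exact: le_lt_trans (grid_point_dist p sz) LN.
Qed.

Theorem KKM : K !=set0 -> exists2 x, K x & forall y, K y -> G y x.
Proof.
move=> K0; move: cptK; rewrite compact_In0 => /(_ X K (fun y => K `&` G y)).
case=> [|D DK|x Kx].
- by exists G.
- have [x Kx Gx] := @KKM_finite _ (@finmap.fsval _ D) K0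
      (fun y => set_mem (DK _ (finmap.fsvalP y))).
  by exists x => y /= yD; split => //; exact: (Gx (finmap.FSetSub yD)).
by have [y Ky] := K0; exists x => [|z /Kx[]//]; have [] := Kx y Ky.
Qed.

End KKM.

(** * Lower semicontinuous regularization *)

Section LscReg.
Variables (R : realType) (X : normedModType R) (h : X -> \bar R).

Lemma closure_epiP x l : closure (epi h) (x, l) <->
  forall e, 0 < e ->
    exists u a, [/\ `|x - u| < e, `|l - a| < e & (h u <= a%:E)%E].
Proof.
split=> [cl e e0|H B /nbhs_ballP[e /= e0 eB]].
  have [|[u a] [hu [/= xu la]]] := cl (ball (x, l) e); first exact: nbhsx_ballx.
  by rewrite -!ball_normE /= in xu la; exists u, a.
have [u [a [xu la hu]]] := H e e0; exists (u, a); split => //.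
by apply: eB; split; rewrite -ball_normE.
Qed.

(** The infimum defining [lsc_reg h x] is attained: the closure of an epigraph is
    closed, and contains with a point all the points above it. *)
Lemma lsc_reg_leP x l : (lsc_reg h x <= l%:E)%E <-> closure (epi h) (x, l).
Proof.
split=> [hl|cl]; last by apply: ereal_inf_lbound; exists l.
apply/closure_epiP => e e0.
have e20 : 0 < e / 2 by rewrite divr_gt0.
have : (lsc_reg h x < (l + e / 2)%:E)%E.
  by rewrite (le_lt_trans hl) // lte_fin ltrDl.
move=> /ereal_inf_lt[_ [l' cl' <-]]; rewrite lte_fin => l'l.
have /closure_epiP/(_ _ e20)[u [a [xu l'a hu]]] := cl'.
exists u, (Num.max a l); split.
- by rewrite (lt_trans xu) // ltr_pdivrMr // ltr_pMr // ltr1n.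
- move: l'a; rewrite ltr_norml => /andP[? ?].
  have [al|la] := leP a l; first by rewrite subrr normr0.
  by rewrite ltr_norml; apply/andP; split; lra.
- by rewrite (le_trans hu) // lee_fin le_max lexx.
Qed.

Lemma lsc_reg_le x : (lsc_reg h x <= h x)%E.
Proof.
have le_hx r : (h x <= r%:E)%E -> (lsc_reg h x <= r%:E)%E.
  by move=> hr; apply/lsc_reg_leP/subset_closure.
case hx : (h x) => [r||].
- by apply: le_hx; rewrite hx.
- by rewrite leey.
- rewrite leeNy_eq; apply/eqP/eq_ninfty => r.
  by apply: le_hx; rewrite hx leNye.
Qed.

Lemma closed_lsc_reg_sublevel l : closed [set x | (lsc_reg h x <= l%:E)%E].
Proof.
have -> : [set x | (lsc_reg h x <= l%:E)%E] =
    (fun x => (x, l)) @^-1` closure (epi h).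
  by apply/seteqP; split=> x /lsc_reg_leP.
apply: closed_comp; last exact: closed_closure.
move=> x _; apply: (@cvg_pair _ _ _ _ (nbhs x) (nbhs l) _ _ _ id (cst l)).
  exact: cvg_id.
exact: cvg_cst.
Qed.

End LscReg.

(** * Existence of equilibria *)

Theorem corollary5p1p2 (R : realType) (X : completeNormedModType R)
    (K : set X) (f : X -> X -> R)
    (K_nonempty : K !=set0) (K_compact : compact K) (K_convex : convex_set K)
    (f_S : bifun_S K f)
    (fs_pqm : properly_quasimonotone K (lsc_bifunR K f))
    (fs_usp : upper_sign_property K (lsc_bifunR K f)) :
  EP f K !=set0.
Proof.
have fineE x y : K x -> K y -> lsc_bifun K f x y = (lsc_bifunR K f x y)%:E.
  by move=> Kx Ky; rewrite /lsc_bifunR fineK //; exact: f_S.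
(* A common point of all the [G y] is a solution of the Minty problem for the
   regularized bifunction. *)
pose G (y : X) := K `&` [set x | (lsc_bifun K f y x <= 0%:E)%E].
have hullK n (p : 'I_n -> X) :
    (forall i, K (p i)) -> convex_hull (range p) `<=` K.
  by move=> Kp x; apply; split => // _ [i _ <-].
have [x Kx Gx] : exists2 x, K x & forall y, K y -> G y x.
  apply: KKM => // [y Ky|n p x Kp px].
    apply: closedI; last exact: closed_lsc_reg_sublevel.
    exact: compact_closed.
  have [i fi] := fs_pqm _ _ _ Kp px; have Kx := hullK _ _ Kp _ px.
  by exists i; split => //; rewrite /= fineE.
exists x; split => // y Ky.
have fs_ge0 : 0 <= lsc_bifunR K f x y.
  apply: fs_usp => // t /andP[t0 t1].
  have Kt : K ((1 - t) *: x + t *: y).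
    rewrite addrC; apply: convex_set_segment => //; by rewrite !ltW.
  by have [_ /=] := Gx _ Kt; rewrite fineE // lee_fin.
rewrite (le_trans fs_ge0) // -lee_fin -fineE //.
by apply: le_trans (lsc_reg_le _ _) _; rewrite patchT // inE.
Qed.
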